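(* Let $G$ be a finite group. The transfer $\mathrm{Tr}_{G\to e}\colon\mathrm{Parks}(G,\mathbb{Q})\to\mathrm{Parks}(e,\mathbb{Q})$ to the trivial group $e$ is given by \[\mathrm{Tr}_{G\to e}(f)(\lambda)=\frac{1}{|G|^{|\lambda|}}\sum_{\substack{c^\sharp=c(\lambda)\\ c\in C(G)}}f(us_*c)\] for $f\in\mathrm{Parks}(G,\mathbb{Q})$ and an integer partition $\lambda\in\mathrm{Parts}(e)$.
   Context: Burnside rings and marks. For a finite group $\Gamma$, $A(\Gamma)$ is the Burnside ring, with canonical $\mathbb{Z}$-basis the isomorphism classes of transitive $\Gamma$-sets; $\mathrm{Conj}(\Gamma)$ is the set of conjugacy classes of subgroups; the marks homomorphism is $\chi\colon A(\Gamma)\to\mathrm{Fun}(\mathrm{Conj}(\Gamma),\mathbb{Z})$, $\chi([X])([K])=|X^K|$. $\mathrm{Tr}_{G\to e}\colon A(G)\to A(e)$ is the additive map induced by $X\mapsto X/G$ (the set of orbits). Power operations. $\Gamma\wr\Sigma_n=\Gamma^{\times n}\rtimes\Sigma_n$ acts on $X^{\times n}$ for a $\Gamma$-set $X$. The transfer product $\star\colon A(\Gamma\wr\Sigma_i)\otimes A(\Gamma\wr\Sigma_j)\to A(\Gamma\wr\Sigma_{i+j})$ is $X\star Y=(\Gamma\wr\Sigma_{i+j})\times_{\Gamma\wr\Sigma_i\times\Gamma\wr\Sigma_j}(X\times Y)$. The total power operations $\mathbb{P}_n\colon A(\Gamma)\to A(\Gamma\wr\Sigma_n)$ are the unique functions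 with $\mathbb{P}_n([X])=[X^{\times n}]$, $\mathbb{P}_0=1$, $\mathbb{P}_n(x+y)=\sum_{i+j=n}\mathbb{P}_i(x)\star\mathbb{P}_j(y)$. $\mathring{A}(\Gamma,n)\subseteq A(\Gamma\wr\Sigma_n)$ is the summand spanned by the smallest subset of the canonical basis whose span contains the image of $\mathbb{P}_n$. $\mathring{A}(\Gamma)=\bigoplus_{n\ge0}\mathring{A}(\Gamma,n)$ is a commutative graded ring under $\star$, polynomial on the generators $\mathbb{P}_n([\Gamma/K])$, $n>0$, $[K]\in\mathrm{Conj}(\Gamma)$. Decorated partitions and compositions. For a set $X$, $P(X)$ is the free commutative monoid on $X\times\mathbb{N}_{>0}$; its elements are finitely supported $\lambda\colon X\times\mathbb{N}_{>0}\to\mathbb{N}$, with $\|\lambda\|=\sum\lambda_{x,m}m$, length $|\lambda|=\sum\lambda_{x,m}$, $\lambda!=\prod\lambda_{x,m}!$. $\mathrm{Parts}(\Gamma)=P(\mathrm{Conj}(\Gamma))$, $\mathrm{Parts}(\Gamma,n)=\{\lambda:\|\lambda\|=n\}$; $\mathrm{Parts}(e)$ is the set of ordinary integer partitions. $C(X)$ is the set of finite sequences $c=(c_1,\dots,c_k)$ with $c_i=(c_i^\flat,c_i^\sharp)\in X\times\mathbb{N}_{>0}$; $c^\sharp=(c_1^\sharp,\dots,c_k^\sharp)$ is the underlying sequence of integers; $uc=\sum_ic_i\in P(X)$. For an integer partition $\lambda$, $c(\lambda)$ denotes an arbitrarily chosen sequence of positive integers whose underlying partition is $\lambda$. $C(G)$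 is the set of such sequences decorated by elements of $G$. Let $s\colon G\to\mathrm{Conj}(G)$, $s(g)=[\langle g\rangle]$ (the class of the cyclic subgroup generated by $g$); $s_*\colon C(G)\to C(\mathrm{Conj}(G))$ applies $s$ to each decoration. Parks. $\mathrm{Parks}(\Gamma,R)$ ($R=\mathbb{Z}$ if omitted) is the set of finitely supported functions $\mathrm{Parts}(\Gamma)\to R$, graded by size, a commutative graded ring under $(f\star g)(\mu)=\sum_{\kappa+\lambda=\mu}\frac{\mu!}{\kappa!\lambda!}f(\kappa)g(\lambda)$. The parks homomorphism $\chi\colon\mathring{A}(\Gamma)\to\mathrm{Parks}(\Gamma)$ is the unique graded ring homomorphism with $\chi(\mathbb{P}_n(x))(\lambda)=\prod_{[K],m}\chi(x)([K])^{\lambda_{[K],m}}$ for $x\in A(\Gamma)$, $\lambda\in\mathrm{Parts}(\Gamma,n)$; it induces an isomorphism $\mathbb{Q}\otimes\mathring{A}(\Gamma)\cong\mathrm{Parks}(\Gamma,\mathbb{Q})$. Transfer on parks. The additive map $F=\mathrm{Tr}_{G\to e}\colon A(G)\to A(e)$ induces the unique graded ring homomorphism $\mathring{F}\colon\mathring{A}(G)\to\mathring{A}(e)$ (for $\star$) with $\mathring{F}(\mathbb{P}_n(x))=\mathbb{P}_n(F(x))$ for all $x\in A(G)$, $n\ge0$. The transfer $\mathrm{Tr}_{G\to e}\colon\mathrm{Parks}(G,\mathbb{Q})\to\mathrm{Parks}(e,\mathbb{Q})$ is the rationalization of $\mathring{F}$ transported along these isomorphisms. *)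

(* Defs.v *)
From HB Require Import structures.
From mathcomp Require Import all_boot all_order all_algebra all_fingroup.
From mathcomp Require Import finmap multiset monalg.

Set Implicit Arguments.
Unset Strict Implicit.
Unset Printing Implicit Defensive.

Import GroupScope GRing.Theory.

(* Finite G-sets. MathComp actions are right actions; a left G-set becomes a
   right one through inversion, which changes neither orbits, stabilisers nor
   fixed points. *)

Record gset (gT : finGroupType) := GSet {
  gset_sort :> finType;
  gset_act : {action gT &-> gset_sort} }.

Section SubGSet.
Variables (gT : finGroupType) (T : finType) (to : {action gT &-> T}).
Variables (S : {set T}) (actS : [acts [set: gT], on S | to]).

Fact sub_gset_subproof (x : {x | x \in S}) a : to (val x) a \in S.
Proof. by rewrite (acts_act actS) ?inE ?(valP x). Qed.

Definition sub_gset_fun (x : {x | x \in S}) (a : gT) : {x | x \in S} :=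
  exist _ (to (val x) a) (sub_gset_subproof x a).

Fact sub_gset_act1 x : sub_gset_fun x 1 = x.
Proof. by apply: val_inj; rewrite /= act1. Qed.

Fact sub_gset_actM x : act_morph sub_gset_fun x.
Proof. by move=> a b; apply: val_inj; rewrite /= actM. Qed.

Definition sub_gset : gset gT := GSet (TotalAction sub_gset_act1 sub_gset_actM).

End SubGSet.

Section BasicGSets.
Variable gT : finGroupType.

Definition trivial_act (T : finType) : {action gT &-> T} :=
  @TotalAction gT T (fun x _ => x) (fun=> erefl) (fun _ _ _ => erefl).

Definition trivial_gset (T : finType) : gset gT := GSet (trivial_act T).

Fact rcosets_stable (H : {group gT}) :
  [acts [set: gT], on rcosets H [set: gT] | 'Rs].
Proof.
apply/subsetP=> a _; rewrite !inE; apply/subsetP=> _ /rcosetsP[x _ ->].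
rewrite inE /= rcosetE -rcosetM.
by apply/rcosetsP; exists (x * a); rewrite ?inE.
Qed.

Definition coset_gset (H : {group gT}) : gset gT :=
  sub_gset (rcosets_stable H).

End BasicGSets.

Section Burnside.
Variable gT : finGroupType.

Definition is_cclass (C : {set {group gT}}) : bool :=
  C \in orbit 'JG [set: gT] @: [set: {group gT}].

Definition Conj := {C : {set {group gT}} | is_cclass C}.

Definition cclass (H : {group gT}) : Conj :=
  exist is_cclass (orbit 'JG [set: gT] H) (imset_f _ (in_setT H)).

Definition conj_rep (C : Conj) : {group gT} := odflt 1%G [pick H in val C].

Lemma conj_repK : cancel conj_rep cclass.
Proof.
case=> C CC; apply: val_inj; rewrite /conj_rep /=.
have /imsetP[H _ defC] := CC.
case: pickP => [K | /(_ H)]; rewrite /= defC ?orbit_refl //.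
by move=> KH; apply/orbit_eqP.
Qed.

(* A(G), in coordinates with respect to its basis of transitive G-sets G/H. *)
Definition burnside := {ffun Conj -> int}.

(* The class [X]: the coordinate at [H] is the number of orbits of X that are
   isomorphic to G/H. *)
Definition gclass (X : gset gT) : burnside :=
  [ffun C => #|[set orbit (gset_act X) [set: gT] x
               | x in [set: X] & cclass 'C[x | gset_act X] == C]|%:Z%R].

(* The additive extension to A(G) of a function defined on finite G-sets. *)
Definition burnside_ext (V : zmodType) (F : gset gT -> V) (a : burnside) : V :=
  (\sum_(C : Conj) F (coset_gset (conj_rep C)) *~ a C)%R.

Definition mark (a : burnside) (K : Conj) : int :=
  burnside_ext (fun X => #|'Fix_(gset_act X)(conj_rep K)|%:Z%R) a.

Definition cyclic_class (g : gT) : Conj := cclass <[g]>.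

End Burnside.

Definition trivg : Type := unit.
HB.instance Definition _ := Finite.copy trivg unit.
Definition trivg_mul (_ _ : trivg) : trivg := tt.
Fact trivg_mulA : associative trivg_mul. Proof. by []. Qed.
Fact trivg_mul1 : left_id (tt : trivg) trivg_mul. Proof. by case. Qed.
Fact trivg_mulV : left_inverse (tt : trivg) id trivg_mul. Proof. by []. Qed.
HB.instance Definition _ :=
  Finite_isGroup.Build trivg trivg_mulA trivg_mul1 trivg_mulV.

Section Transfer.
Variable gT : finGroupType.

Definition gset_orbits (X : gset gT) : {set {set X}} :=
  orbit (gset_act X) [set: gT] @: [set: X].

Definition orbit_gset (X : gset gT) : gset trivg :=
  trivial_gset trivg {O : {set X} | O \in gset_orbits X}.

Definition burnside_tr (a : burnside gT) : burnside trivg :=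
  burnside_ext (fun X => gclass (orbit_gset X)) a.

End Transfer.

(* The balanced product X x_aT bT along phi : aT -> bT: the orbits of the
   aT-action (x, w) a = (x a, phi(a)^-1 w), on which bT acts by translating w. *)
Section Induction.
Variables (aT bT : finGroupType) (phi : {morphism [set: aT] >-> bT}).
Variable X : gset aT.

Definition bal_fun (t : X * bT) (a : aT) : X * bT :=
  (gset_act X t.1 a, (phi a)^-1 * t.2).

Fact bal_act1 t : bal_fun t 1 = t.
Proof. by case: t => x w; rewrite /bal_fun /= act1 morph1 invg1 mul1g. Qed.

Fact bal_actM t : act_morph bal_fun t.
Proof.
by move=> a b; rewrite /bal_fun /= actM morphM ?inE // invMg mulgA.
Qed.

Canonical bal_act := TotalAction bal_act1 bal_actM.

Definition trans_fun (t : X * bT) (b : bT) : X * bT := (t.1, t.2 * b).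

Fact trans_act1 t : trans_fun t 1 = t.
Proof. by case: t => x w; rewrite /trans_fun /= mulg1. Qed.

Fact trans_actM t : act_morph trans_fun t.
Proof. by move=> a b; rewrite /trans_fun /= mulgA. Qed.

Canonical trans_act := TotalAction trans_act1 trans_actM.

Fact bal_orbits_stable :
  [acts [set: bT], on orbit bal_act [set: aT] @: [set: X * bT] | trans_act^*].
Proof.
apply/subsetP=> b _; rewrite !inE; apply/subsetP=> _ /imsetP[t _ ->].
rewrite inE /=; apply/imsetP; exists (trans_fun t b); rewrite ?inE //.
rewrite /orbit /= /setact -imset_comp; apply: eq_imset => a /=.
by rewrite /trans_fun /bal_fun /= mulgA.
Qed.

Definition induced_gset : gset bT := sub_gset bal_orbits_stable.

End Induction.

Section ProductGSet.
Variables (aT bT : finGroupType) (X : gset aT) (Y : gset bT).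

Definition prod_fun (t : X * Y) (g : aT * bT) : X * Y :=
  (gset_act X t.1 g.1, gset_act Y t.2 g.2).

Fact prod_act1 t : prod_fun t 1 = t.
Proof. by case: t => x y; rewrite /prod_fun /= !act1. Qed.

Fact prod_actM t : act_morph prod_fun t.
Proof. by move=> a b; rewrite /prod_fun /= !actM. Qed.

Definition prod_gset : gset (aT * bT)%type :=
  GSet (TotalAction prod_act1 prod_actM).

End ProductGSet.

(* The wreath product: (g, s) acts on x in X^n by ((x (g, s))_(s i) = x_i g_i),
   which fixes the product given MathComp's (s * t) i = t (s i). *)
Definition wreath (gT : finGroupType) (n : nat) : Type :=
  ({ffun 'I_n -> gT} * 'S_n)%type.

Section Wreath.
Variables (gT : finGroupType) (n : nat).
Implicit Types u v : wreath gT n.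

HB.instance Definition _ :=
  Finite.copy (wreath gT n) ({ffun 'I_n -> gT} * 'S_n)%type.

Definition wreath_mul u v : wreath gT n :=
  ([ffun i => u.1 i * v.1 (u.2 i)], u.2 * v.2).
Definition wreath_one : wreath gT n := ([ffun=> 1], 1).
Definition wreath_inv u : wreath gT n :=
  ([ffun i => (u.1 (u.2^-1 i))^-1], u.2^-1).

Fact wreath_mulA : associative wreath_mul.
Proof.
move=> u v w; rewrite /wreath_mul /= mulgA; congr (_, _).
by apply/ffunP=> i; rewrite !ffunE permM mulgA.
Qed.

Fact wreath_mul1 : left_id wreath_one wreath_mul.
Proof.
case=> g s; rewrite /wreath_mul /= mul1g; congr (_, _).
by apply/ffunP=> i; rewrite !ffunE perm1 mul1g.
Qed.

Fact wreath_mulV : left_inverse wreath_one wreath_inv wreath_mul.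
Proof.
case=> g s; rewrite /wreath_mul /= mulVg; congr (_, _).
by apply/ffunP=> i; rewrite !ffunE mulVg.
Qed.

HB.instance Definition _ :=
  Finite_isGroup.Build (wreath gT n) wreath_mulA wreath_mul1 wreath_mulV.

Variable X : gset gT.

Definition power_fun (x : {ffun 'I_n -> X}) (u : wreath gT n) :=
  [ffun k => gset_act X (x (u.2^-1 k)) (u.1 (u.2^-1 k))].

Fact power_act1 x : power_fun x 1 = x.
Proof. by apply/ffunP=> k; rewrite !ffunE invg1 perm1 act1. Qed.

Fact power_actM x : act_morph power_fun x.
Proof.
move=> u v; apply/ffunP=> k; rewrite !ffunE /= invMg permM.
by rewrite permKV actM.
Qed.

Definition power_gset : gset (wreath gT n) :=
  GSet (TotalAction power_act1 power_actM).

End Wreath.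

Section TransferProduct.
Variables (gT : finGroupType) (m n : nat).

Definition block_fun (s : 'S_m) (t : 'S_n) (k : 'I_(m + n)) : 'I_(m + n) :=
  match split k with inl i => lshift n (s i) | inr j => rshift m (t j) end.

Fact block_fun_inj s t : injective (block_fun s t).
Proof.
move=> k l; rewrite -[k]splitK -[l]splitK /block_fun !unsplitK.
case: (split k) (split l) => [i|j] [i'|j'] /= /eqP.
- by rewrite eq_lshift => /eqP/perm_inj->.
- by rewrite eq_lrshift.
- by rewrite eq_rlshift.
- by rewrite eq_rshift => /eqP/perm_inj->.
Qed.

Definition block_emb (u : wreath gT m * wreath gT n) : wreath gT (m + n) :=
  ([ffun k => match split k with inl i => u.1.1 i | inr j => u.2.1 j end],
   perm (@block_fun_inj u.1.2 u.2.2)).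

Fact block_embM : {in [set: wreath gT m * wreath gT n] &,
  {morph block_emb : u v / u * v}}.
Proof.
move=> [u1 u2] [v1 v2] _ _; congr (_, _).
  apply/ffunP=> k; rewrite !ffunE /= permE /block_fun.
  by case: (split k) => i; rewrite !ffunE (unsplitK (inl _), unsplitK (inr _)).
apply/permP=> k; rewrite permM !permE /block_fun /=.
by case: (split k) => i; rewrite (unsplitK (inl _), unsplitK (inr _)) /= permM.
Qed.

Canonical block_morphism := Morphism block_embM.

Definition transfer_gset (X : gset (wreath gT m)) (Y : gset (wreath gT n)) :
  gset (wreath gT (m + n)) := induced_gset block_morphism (prod_gset X Y).

Definition transfer_prod
    (a : burnside (wreath gT m)) (b : burnside (wreath gT n)) :
    burnside (wreath gT (m + n)) :=
  burnside_ext
    (fun X => burnside_ext (fun Y => gclass (transfer_gset X Y)) b) a.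

End TransferProduct.

Section PowerOperations.
Variable gT : finGroupType.
Local Open Scope ring_scope.

Definition burnside_one (hT : finGroupType) : burnside hT :=
  gclass (trivial_gset hT unit).

Definition is_total_power
    (P : forall n, burnside gT -> burnside (wreath gT n)) : Prop :=
  [/\ forall n (X : gset gT), P n (gclass X) = gclass (power_gset n X),
      forall x, P 0%N x = burnside_one (wreath gT 0)
    & forall n x y, P n (x + y) =
        \sum_(i < n.+1) ecast k (burnside (wreath gT k)) (subnKC (leq_ord i))
                          (transfer_prod (P i x) (P (n - i)%N y))].

Definition in_span (hT : finGroupType) (B : {set Conj hT}) (a : burnside hT) :=
  forall C, C \notin B -> a C = 0.

(* Membership in the span of the smallest set of basis elements whose span contains the
   image of P_n, namely of the intersection of all such sets. *)
Definition power_summand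
    (P : forall n, burnside gT -> burnside (wreath gT n)) n
    (a : burnside (wreath gT n)) : Prop :=
  forall B : {set Conj (wreath gT n)}, (forall x, in_span B (P n x)) -> in_span B a.

End PowerOperations.

Definition posnat := {m : nat | (0 < m)%N}.

Section Partitions.
Variable X : choiceType.
Local Open Scope nat_scope.

Definition partition := {mset (X * posnat)}%mset.
Implicit Type l : partition.

Definition psize l := \sum_(p <- finsupp l) l p * val p.2.
Definition plength l := \sum_(p <- finsupp l) l p.
Definition pfact l := \prod_(p <- finsupp l) (l p)`!.

Definition composition := seq (X * posnat).

Definition comp_sharp (c : composition) : seq posnat := [seq p.2 | p <- c].
Definition comp_partition (c : composition) : partition := seq_mset c.

End Partitions.

Definition comp_map (X Y : choiceType) (f : X -> Y) (c : composition X) :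
  composition Y := [seq (f p.1, p.2) | p <- c].

(* The finitely many compositions decorated by X with c^# = d. *)
Definition decorations (X : finType) (d : seq posnat) : seq (composition X) :=
  [seq zip (val t) d | t : (size d).-tuple X].

Lemma mem_decorations (X : finType) (d : seq posnat) (c : composition X) :
  (c \in decorations X d) = (comp_sharp c == d).
Proof.
apply/imageP/eqP => [[t _ ->] | <-].
  by rewrite /comp_sharp -/(unzip2 _) unzip2_zip ?size_tuple.
have sz : size (unzip1 c) == size (comp_sharp c) by rewrite !size_map.
by exists (Tuple sz) => //=; rewrite zip_unzip.
Qed.

Lemma decorations_uniq (X : finType) (d : seq posnat) : uniq (decorations X d).
Proof.
rewrite map_inj_in_uniq ?enum_uniq // => s t _ _ /(congr1 unzip1).
by rewrite !unzip1_zip ?size_tuple // => /val_inj.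
Qed.

Definition Parts (gT : finGroupType) := partition (Conj gT).

(* Only the module structure of {malg R[_]} is used: parks have their own
   product parks_mul, whose coefficients mu! / (kappa! lambda!) are integers
   (products of binomials), so that the division in nat is exact. *)
Definition Parks (gT : finGroupType) (R : comNzRingType) := {malg R[Parts gT]}.

Section Parks.
Variable gT : finGroupType.
Local Open Scope ring_scope.

Definition parks_one (R : comNzRingType) : Parks gT R := << mset0 >>.

Definition parks_mul (R : comNzRingType) (f g : Parks gT R) : Parks gT R :=
  \sum_(k <- msupp f) \sum_(l <- msupp g)
    << (pfact (msetD k l) %/ (pfact k * pfact l))%N%:R * (f@_k * g@_l)
       *g msetD k l >>.

Definition parks_rat (f : Parks gT int) : Parks gT rat :=
  [malg l in msupp f => (f@_l)%:~R].

Definition is_parks_hom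
    (P : forall n, burnside gT -> burnside (wreath gT n))
    (chi : forall n, burnside (wreath gT n) -> Parks gT int) : Prop :=
  [/\ forall n x (l : Parts gT), psize l = n ->
        (chi n (P n x))@_l = \prod_(p <- finsupp l) mark x p.1 ^+ l p,
      forall n a (l : Parts gT), power_summand P a -> psize l != n ->
        (chi n a)@_l = 0,
      forall n a b, power_summand P a -> power_summand P b ->
        chi n (a - b) = chi n a - chi n b,
      chi 0%N (burnside_one _) = parks_one int
    & forall m n a b, power_summand P a -> power_summand P b ->
        chi (m + n)%N (transfer_prod a b) = parks_mul (chi m a) (chi n b)].

End Parks.

Section ParksTransfer.
Variable gT : finGroupType.
Local Open Scope ring_scope.

(* For an additive map F, the graded ring homomorphism it induces between the
   rings of power summands. *)
Definition is_power_hom (hT : finGroupType)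
    (F : burnside gT -> burnside hT)
    (PG : forall n, burnside gT -> burnside (wreath gT n))
    (PH : forall n, burnside hT -> burnside (wreath hT n))
    (Fo : forall n, burnside (wreath gT n) -> burnside (wreath hT n)) : Prop :=
  [/\ forall n x, Fo n (PG n x) = PH n (F x),
      forall n a, power_summand PG a -> power_summand PH (Fo n a),
      forall n a b, power_summand PG a -> power_summand PG b ->
        Fo n (a - b) = Fo n a - Fo n b,
      Fo 0%N (burnside_one _) = burnside_one _
    & forall m n a b, power_summand PG a -> power_summand PG b ->
        Fo (m + n)%N (transfer_prod a b) = transfer_prod (Fo m a) (Fo n b)].

(* Tr_{G -> e} on rational parks: the Q-linear map that corresponds, under the
   parks homomorphisms of G and e, to the homomorphism induced by the transfer
   A(G) -> A(e). *)
Definition is_parks_transfer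
    (Tr : {linear Parks gT rat -> Parks trivg rat}) : Prop :=
  exists PG Pe chiG chie Fo,
    [/\ @is_total_power gT PG, @is_total_power trivg Pe,
        is_parks_hom PG chiG
      & [/\ is_parks_hom Pe chie,
            is_power_hom (@burnside_tr gT) PG Pe Fo
          & forall n a, power_summand PG a ->
              Tr (parks_rat (chiG n a)) = parks_rat (chie n (Fo n a))]].

End ParksTransfer.

(* Parts e is the set of integer partitions since e has a single subgroup. The
   sequence d of positive integers has underlying partition l. *)
Definition underlies (d : seq posnat) (l : Parts trivg) : Prop :=
  comp_partition [seq (cclass [1 trivg], m) | m <- d] = l.

(* Main.v *)
Require Import Defs.
From HB Require Import structures.
From mathcomp Require Import all_boot all_order all_algebra all_fingroup.
From mathcomp Require Import finmap multiset monalg.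

Set Implicit Arguments.
Unset Strict Implicit.
Unset Printing Implicit Defensive.

Import GRing.Theory Num.Theory.
Local Open Scope ring_scope.

(** A park f is determined by its values f(u c) on compositions c. Read on
    compositions, the product of parks is the shuffle product of functions on
    sequences: the multinomial factor mu! / (kappa! lambda!) counts the ways to
    distribute the entries of c over two complementary subsequences with
    multisets kappa and lambda ([park_value_mul]). The shuffle product is
    defined by recursion on the sequence, removing the first entry being a
    derivation, and this makes associativity and the behaviour under averaging
    immediate inductions.

    The right hand side of the formula is the average, over the decorations of
    d by elements of G, of the values of f. Averaging is multiplicative for the
    shuffle product ([average_shuffle]), so both sides of the formula behave
    multiplicatively in f. On the park of P_n(x), which is the degree n part of
    an exponential with weights the marks of x, the formula reduces to
    |X/G| = 1/|G| sum_g |X^g|, the orbit counting lemma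
    ([mark_burnside_tr], [transfer_formula_power]). It therefore holds on all
    products P_{n_1}[X_1] * ... * P_{n_k}[X_k].

    Two points remain. Multiplicativity of the parks homomorphism is available
    only inside the power summands, and such a product lies there because, all
    coefficients being nonnegative, it is bounded by
    P_{n_1 + ... + n_k}([X_1] + ... + [X_k]) ([power_product_le]).
    Secondly, these products span the rational parks ([power_span_full]):
    Newton's identities extract from the exponentials the parks supported on
    compositions of length one, the triangularity of the table of marks
    separates the conjugacy classes ([mark_table_inv]), and every monomial is
    up to a scalar a product of monomials of length one
    ([exponentials_generate]). *)

(** * The shuffle product *)

Section ShuffleDef.
Variables (R : pzSemiRingType) (T : Type).
Implicit Types F G H : seq T -> R.

Fixpoint shuffle F G (c : seq T) : R :=
  if c is p :: c' then
    shuffle (fun s => F (p :: s)) G c' + shuffle F (fun s => G (p :: s)) c'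
  else F [::] * G [::].

Lemma eq_shuffle F F' G G' c :
  F =1 F' -> G =1 G' -> shuffle F G c = shuffle F' G' c.
Proof.
elim: c F F' G G' => [|p c IH] F F' G G' eF eG /=; first by rewrite eF eG.
by congr (_ + _); apply: IH => s; rewrite ?eF ?eG.
Qed.

Lemma shuffle0l G c : shuffle (fun=> 0) G c = 0.
Proof. by elim: c G => [|p c IH] G /=; rewrite ?mul0r // !IH addr0. Qed.

Lemma shuffle0r F c : shuffle F (fun=> 0) c = 0.
Proof. by elim: c F => [|p c IH] F /=; rewrite ?mulr0 // !IH addr0. Qed.

Lemma shuffleDl F F' G c :
  shuffle (fun s => F s + F' s) G c = shuffle F G c + shuffle F' G c.
Proof.
by elim: c F F' G => [|p c IH] F F' G /=; rewrite ?mulrDl // !IH addrACA.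
Qed.

Lemma shuffleDr F G G' c :
  shuffle F (fun s => G s + G' s) c = shuffle F G c + shuffle F G' c.
Proof.
by elim: c F G G' => [|p c IH] F G G' /=; rewrite ?mulrDr // !IH addrACA.
Qed.

Lemma shuffle_suml I (r : seq I) (F : I -> seq T -> R) G c :
  shuffle (fun s => \sum_(i <- r) F i s) G c = \sum_(i <- r) shuffle (F i) G c.
Proof.
elim: r => [|i r IH].
  by rewrite big_nil -[RHS](shuffle0l G c); apply: eq_shuffle => // s; rewrite big_nil.
rewrite big_cons -IH -shuffleDl; apply: eq_shuffle => // s.
by rewrite big_cons.
Qed.

Lemma shuffle_sumr I (r : seq I) F (G : I -> seq T -> R) c :
  shuffle F (fun s => \sum_(i <- r) G i s) c = \sum_(i <- r) shuffle F (G i) c.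
Proof.
elim: r => [|i r IH].
  by rewrite big_nil -[RHS](shuffle0r F c); apply: eq_shuffle => // s; rewrite big_nil.
rewrite big_cons -IH -shuffleDr; apply: eq_shuffle => // s.
by rewrite big_cons.
Qed.

Lemma shuffleZl a F G c : shuffle (fun s => a * F s) G c = a * shuffle F G c.
Proof.
by elim: c F G => [|p c IH] F G /=; rewrite -?mulrA // !IH mulrDr.
Qed.

Lemma shuffleA F G H c : shuffle (shuffle F G) H c = shuffle F (shuffle G H) c.
Proof.
elim: c F G H => [|p c IH] F G H /=; first by rewrite mulrA.
by rewrite shuffleDl shuffleDr !IH addrA.
Qed.

Lemma shuffle_scalar a G c :
  shuffle (fun s => if s is [::] then a else 0) G c = a * G c.
Proof.
by elim: c G => [|p c IH] G //=; rewrite shuffle0l IH add0r.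
Qed.

End ShuffleDef.

Lemma shuffleZr (R : comPzSemiRingType) T a (F G : seq T -> R) c :
  shuffle F (fun s => a * G s) c = a * shuffle F G c.
Proof.
elim: c F G => [|p c IH] F G /=; first by rewrite mulrCA.
by rewrite !IH mulrDr.
Qed.

Lemma shuffle_morph (R S : pzSemiRingType) (h : {rmorphism R -> S}) T
    (F G : seq T -> R) c :
  shuffle (fun s => h (F s)) (fun s => h (G s)) c = h (shuffle F G c).
Proof.
elim: c F G => [|p c IH] F G /=; first by rewrite rmorphM.
by rewrite !IH rmorphD.
Qed.

Lemma shuffle_map (R : pzSemiRingType) T S (h : T -> S) (F G : seq S -> R) c :
  shuffle F G (map h c) =
  shuffle (fun s => F (map h s)) (fun s => G (map h s)) c.
Proof. by elim: c F G => [|p c IH] F G //=; rewrite !IH. Qed.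

Lemma shuffleC (R : comPzSemiRingType) T (F G : seq T -> R) c :
  shuffle F G c = shuffle G F c.
Proof.
elim: c F G => [|p c IH] F G /=; first by rewrite mulrC.
by rewrite addrC [in LHS]IH [X in _ + X]IH.
Qed.

(* finset also defines a predicate of that name. *)
Local Notation partition := Defs.partition.

(** * Multinomial coefficients count shuffles *)

Section Multisets.
Variable X : choiceType.
Local Open Scope mset_scope.
Implicit Types (k l : partition X) (c : composition X) (p : X * posnat).

Lemma seq_mset_nil : seq_mset [::] = mset0 :> partition X.
Proof. by apply/msetP=> p; rewrite mset_seqE mset0E. Qed.

Lemma seq_mset_cons p c : seq_mset (p :: c) = p +` seq_mset c.
Proof. by apply/msetP=> q; rewrite mset1DE !mset_seqE /= eq_sym. Qed.

Lemma seq_mset_ind (P : partition X -> Prop) :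
  (forall c, P (seq_mset c)) -> forall l, P l.
Proof. by move=> Pc l; rewrite -[l]seq_mset_id. Qed.

Lemma pfact_widen (s : seq (X * posnat)) l :
  uniq s -> {subset finsupp l <= s} -> pfact l = (\prod_(p <- s) (l p)`!)%N.
Proof.
move=> Us sub; rewrite (bigID (mem (finsupp l))) /= [X in (_ * X)%N]big1; last first.
  by move=> p; rewrite msuppE -mset_eq0 => /eqP->.
rewrite muln1 /pfact -[RHS]big_filter; apply: perm_big; apply: uniq_perm.
- exact: fset_uniq.
- exact: filter_uniq.
move=> p; rewrite mem_filter /=; case: (boolP (p \in finsupp l)) => //= pl.
by rewrite (sub _ pl).
Qed.

Lemma pfact_cons p l : pfact (p +` l) = ((l p).+1 * pfact l)%N.
Proof.
have sub : {subset finsupp l <= finsupp (p +` l)}.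
  by move=> q; rewrite !msuppE; apply: mset1Dr.
rewrite (pfact_widen (fset_uniq _) sub) /pfact.
have pin : p \in finsupp (p +` l) by rewrite msuppE mset1D1.
rewrite !(bigD1_seq p pin (fset_uniq _)) /= mset1DE eqxx add1n factS.
rewrite -mulnA; congr (_ * (_ * _))%N; apply: eq_bigr => q nqp.
by rewrite mset1DE (negPf nqp).
Qed.

Lemma pfact0 : pfact (mset0 : partition X) = 1%N.
Proof. by rewrite /pfact big1 // => p; rewrite mset0E. Qed.

Lemma pfact_gt0 l : (0 < pfact l)%N.
Proof. by apply: prodn_gt0 => p; apply: fact_gt0. Qed.

Lemma eq_mset_cons p s k : (p +` s == k) = (p \in k) && (s == k `\ p).
Proof.
apply/eqP/andP => [<- | [pk /eqP->]]; last by rewrite msetB1K.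
by rewrite mset1D1 msetD1K.
Qed.

(** The left factor counts the distributions of the entries of c over two
    complementary subsequences with multisets k and l. Removing the first entry
    p of c divides c! by c(p) = k(p) + l(p), and the two summands account for
    the two subsequences that p can belong to. The product form keeps the
    division by k! l! out of the induction. *)
Lemma shuffle_indicators k l c :
  (shuffle (fun s => (seq_mset s == k) : nat) (fun s => (seq_mset s == l) : nat) c
    * (pfact k * pfact l) = (seq_mset c == k `+` l) * pfact (seq_mset c))%N.
Proof.
elim: c k l => [|p c IH] k l.
  rewrite /= seq_mset_nil pfact0 muln1.
  have [<-|nk] := eqVneq mset0 k.
    rewrite mset0D pfact0 mul1n -[LHS]mulnA mul1n.
    by case: eqP => [<-|_]; rewrite ?pfact0.
  have -> : (mset0 == k `+` l) = false; last by rewrite mul0r.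
  apply/negP=> /eqP/msetP e; case/eqP: nk; apply/msetP=> q; move: (e q).
  by rewrite msetE2 mset0E => /esym/eqP; rewrite addn_eq0 => /andP[/eqP->].
(* The contribution of the distributions that put p into the first part. *)
have half (k' l' : partition X) (G : composition X -> nat) :
    (forall m, shuffle (fun s => (seq_mset s == m) : nat) G c
       * (pfact m * pfact l') = (seq_mset c == m `+` l') * pfact (seq_mset c))%N ->
    (shuffle (fun s => (seq_mset (p :: s) == k') : nat) G c * (pfact k' * pfact l')
     = (p +` seq_mset c == k' `+` l') * (k' p * pfact (seq_mset c)))%N.
  move=> IHG; case: (boolP (p \in k')) => [pk | npk]; last first.
    rewrite (mset_eq0P npk) mul0n muln0.
    rewrite (@eq_shuffle _ _ _ (fun=> 0) _ G) ?shuffle0l // => s.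
    by rewrite seq_mset_cons eq_mset_cons (negPf npk).
  rewrite -{2 3 4}(msetB1K pk) pfact_cons -[in X in _ = X]msetDA.
  rewrite !eq_mset_cons in_mset1D eqxx /= msetD1K.
  rewrite mset1DE eqxx add1n [RHS]mulnCA -IHG.
  rewrite -[in LHS](mulnA _ _ (pfact l')) [LHS]mulnCA; congr (_ * (_ * _))%N.
  apply: eq_shuffle => // s.
  by rewrite seq_mset_cons eq_mset_cons pk.
rewrite /= mulnDl half; last by move=> m; apply: IH.
rewrite shuffleC (mulnC (pfact k)) half; last first.
  by move=> m; rewrite shuffleC (mulnC (pfact m)) msetDC; apply: IH.
rewrite seq_mset_cons pfact_cons (msetDC l) -mulnDr -mulnDl.
case: eqP => //= e; rewrite !mul1n; congr (_ * _)%N.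
by have /msetP/(_ p) := e; rewrite mset1DE eqxx msetE2 add1n => ->.
Qed.

End Multisets.

Lemma shuffle_indicatorsE (X : choiceType) (k l : partition X) (c : composition X) :
  shuffle (fun s => (seq_mset s == k) : nat) (fun s => (seq_mset s == l) : nat) c
  = ((seq_mset c == msetD k l) * (pfact (msetD k l) %/ (pfact k * pfact l)))%N.
Proof.
have pos : (0 < pfact k * pfact l)%N by rewrite muln_gt0 !pfact_gt0.
have := shuffle_indicators k l c; case: eqP => [->|_] => [|/eqP].
  by rewrite !mul1n => <-; rewrite mulnK.
by rewrite !mul0n muln_eq0 (gtn_eqF pos) orbF => /eqP.
Qed.

(** * Parks as functions on compositions *)

Section ParksValues.
Variable gT : finGroupType.

Section Coefficients.
Variable R : comNzRingType.
Implicit Types f g : Parks gT R.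

Definition park_value f (c : composition (Conj gT)) : R := f@_(comp_partition c).

Lemma park_valueP f g : park_value f =1 park_value g -> f = g.
Proof.
by move=> e; apply/malgP=> l; rewrite -[l]seq_mset_id; apply: e.
Qed.

Lemma park_value_expand f c :
  park_value f c = \sum_(k <- msupp f) f@_k * ((seq_mset c == k) : nat)%:R.
Proof.
rewrite /park_value {1}(monalgE f) raddf_sum; apply: eq_bigr => k _ /=.
by rewrite mcoeffU eq_sym mulr_natr.
Qed.

(** The bridge from parks to sequences: by bilinearity it is enough to multiply
    two indicator functions of partitions, which is a count of shuffles. *)
Lemma park_value_mul f g c :
  park_value (parks_mul f g) c = shuffle (park_value f) (park_value g) c.
Proof.
rewrite (eq_shuffle c (park_value_expand f) (park_value_expand g)).
rewrite shuffle_suml /park_value raddf_sum; apply: eq_bigr => k _ /=.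
rewrite shuffle_sumr raddf_sum; apply: eq_bigr => l _ /=.
rewrite shuffleZl shuffleZr mcoeffU.
have /= -> := shuffle_morph (GRing.natmul 1) (fun s => (seq_mset s == k) : nat)
  (fun s => (seq_mset s == l) : nat) c.
rewrite shuffle_indicatorsE eq_sym /comp_partition; case: eqP => _ /=.
  by rewrite mulr1n mul1n mulrC -mulrA.
by rewrite mul0n !mulr0.
Qed.

Lemma park_value_one c : park_value (parks_one gT R) c = (c == [::])%:R.
Proof.
rewrite /park_value mcoeffU /comp_partition; congr (_%:R); congr (nat_of_bool _).
case: c => [|p c]; first by rewrite seq_mset_nil !eqxx.
rewrite seq_mset_cons; apply/negbTE/eqP => /msetP/(_ p).
by rewrite mset0E mset1DE eqxx.
Qed.

Lemma park_valueD f g c : park_value (f + g) c = park_value f c + park_value g c.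
Proof. exact: mcoeffD. Qed.

Lemma park_valueZ a f c : park_value (a *: f) c = a * park_value f c.
Proof. exact: mcoeffZ. Qed.

(** Here and in the next lemmas, equations between products are chained with
    etrans: rewriting would compare two products up to conversion and unfold
    the sums that define them. *)
Lemma parks_mulA (f g h : Parks gT R) :
  parks_mul (parks_mul f g) h = parks_mul f (parks_mul g h).
Proof.
apply: park_valueP => c.
apply: (etrans (park_value_mul _ _ c)); apply: etrans (esym (park_value_mul _ _ c)).
rewrite (eq_shuffle c (park_value_mul f g) (fun=> erefl)) shuffleA.
by apply: eq_shuffle => // s; rewrite (park_value_mul g h s).
Qed.

Lemma parks_mulDl (f f' g : Parks gT R) :
  parks_mul (f + f') g = parks_mul f g + parks_mul f' g.
Proof.
apply: park_valueP => c; apply: (etrans (park_value_mul _ _ c)).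
apply: etrans (esym (park_valueD _ _ c)).
rewrite (congr2 +%R (park_value_mul _ _ c) (park_value_mul _ _ c)) -shuffleDl.
by apply: eq_shuffle => // s; apply: park_valueD.
Qed.

Lemma parks_mulDr (f g g' : Parks gT R) :
  parks_mul f (g + g') = parks_mul f g + parks_mul f g'.
Proof.
apply: park_valueP => c; apply: (etrans (park_value_mul _ _ c)).
apply: etrans (esym (park_valueD _ _ c)).
rewrite (congr2 +%R (park_value_mul _ _ c) (park_value_mul _ _ c)) -shuffleDr.
by apply: eq_shuffle => // s; apply: park_valueD.
Qed.

Lemma parks_mulZl a (f g : Parks gT R) : parks_mul (a *: f) g = a *: parks_mul f g.
Proof.
apply: park_valueP => c; apply: (etrans (park_value_mul _ _ c)).
apply: etrans (esym (park_valueZ _ _ c)).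
rewrite (congr1 _ (park_value_mul _ _ c)) -shuffleZl.
by apply: eq_shuffle => // s; apply: park_valueZ.
Qed.

Lemma parks_mulZr a (f g : Parks gT R) : parks_mul f (a *: g) = a *: parks_mul f g.
Proof.
apply: park_valueP => c; apply: (etrans (park_value_mul _ _ c)).
apply: etrans (esym (park_valueZ _ _ c)).
rewrite (congr1 _ (park_value_mul _ _ c)) -shuffleZr.
by apply: eq_shuffle => // s; apply: park_valueZ.
Qed.

End Coefficients.

Lemma parks_ratE (f : Parks gT int) l : (parks_rat f)@_l = (f@_l)%:~R.
Proof. by rewrite mcoeffE; case: msuppP => //; rewrite rmorph0. Qed.

Lemma park_value_rat (f : Parks gT int) c :
  park_value (parks_rat f) c = (park_value f c)%:~R.
Proof. exact: parks_ratE. Qed.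

Lemma parks_rat_mul (f g : Parks gT int) :
  parks_rat (parks_mul f g) = parks_mul (parks_rat f) (parks_rat g).
Proof.
apply: park_valueP => c; apply: etrans (esym (park_value_mul _ _ c)).
apply: (etrans (park_value_rat _ c)); rewrite (congr1 _ (park_value_mul f g c)).
rewrite -(shuffle_morph intr); apply: eq_shuffle => s;
  by rewrite park_value_rat.
Qed.

Lemma parks_rat_one : parks_rat (parks_one gT int) = parks_one gT rat.
Proof. by apply/malgP=> l; rewrite parks_ratE !mcoeffU rmorphMn. Qed.

End ParksValues.

(** * Exponentials and Newton's identities *)

Section Exponential.
Variables (R : comNzRingType) (T : Type) (w : T -> nat) (a : T -> R).
Implicit Type c : seq T.

(** The degree n part of exp(sum_p a_p t_p), with t_p of degree w p, since a
    function on multisets has the exponential generating function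
    sum_mu f(mu) t^mu / mu!. *)
Definition exp_part n c : R := (sumn (map w c) == n)%:R * \prod_(p <- c) a p.

(** The degree m part of sum_p a_p t_p, the logarithm of the exponential. *)
Definition linear_part m c : R :=
  if c is [:: p] then (w p == m)%:R * a p else 0.

Lemma exp_part_cons n j p c :
  (j + sumn (map w (p :: c)) == n)%N%:R * (\prod_(q <- p :: c) a q)
  = a p * ((j + w p + sumn (map w c) == n)%N%:R * \prod_(q <- c) a q).
Proof. by rewrite big_cons mulrCA /= addnA. Qed.

(** Newton's identity with the size of the exponential factor shifted by j: the
    induction removes an entry p from c, which turns j into j + w p. On a
    sequence c the sum chooses the entry that goes to the linear factor, with
    weight its size, so that the weights add up to the size of c. *)
Lemma newton_offset n j c :
  \sum_(m < n.+1) m%:R * shuffle (linear_part m)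
      (fun s => (j + m + sumn (map w s) == n)%N%:R * \prod_(p <- s) a p) c
  = (sumn (map w c))%:R *
    ((j + sumn (map w c) == n)%N%:R * \prod_(p <- c) a p).
Proof.
elim: c j => [|p c IH] j.
  by rewrite big1 ?mul0r // => m _; rewrite /= mul0r mulr0.
rewrite exp_part_cons /= natrD mulrDl.
under eq_bigr => m _ do rewrite mulrDr.
rewrite big_split /=; congr (_ + _).
  have lin_cons m (G : seq T -> R) :
      shuffle (fun s => linear_part m (p :: s)) G c = (w p == m)%:R * a p * G c.
    exact: shuffle_scalar.
  under eq_bigr => m _ do rewrite lin_cons.
  have [wp|wp] := ltnP (w p) n.+1; last first.
    rewrite big1 => [|m _].
      rewrite (_ : (_ == n) = false) ?(mul0r, mulr0) //.
      by apply/negbTE; rewrite neq_ltn orbC -addnA addnCA ltn_addr.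
    by rewrite (gtn_eqF (leq_trans (ltn_ord m) wp)) !(mul0r, mulr0).
  rewrite (bigD1 (Ordinal wp)) //= eqxx mul1r [X in _ + X]big1 ?addr0 // => m nm.
  rewrite (_ : (w p == m) = false) ?(mul0r, mulr0) //.
  by apply: contraNF nm => /eqP e; apply/eqP/val_inj.
rewrite mulrCA -IH mulr_sumr; apply: eq_bigr => m _.
rewrite [RHS]mulrCA -[a p * _]shuffleZr; congr (_ * _); apply: eq_shuffle => // s.
by rewrite exp_part_cons; congr (_ * (_ * _)); rewrite -!addnA (addnCA (w p)).
Qed.

Lemma newton n c :
  \sum_(m < n.+1) m%:R * shuffle (linear_part m) (exp_part (n - m)%N) c
  = n%:R * exp_part n c.
Proof.
have := newton_offset n 0 c; rewrite add0n => e.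
transitivity ((sumn (map w c))%:R * exp_part n c); last first.
  by rewrite /exp_part; case: eqP => [->|]; rewrite ?mul0r ?mulr0.
rewrite -e; apply: eq_bigr => m _; congr (_ * _); apply: eq_shuffle => // s.
by rewrite /exp_part -[in LHS](eqn_add2l m) subnKC // -ltnS.
Qed.

End Exponential.

(** * Exponentials generate the rational parks *)

Section Generation.
Variable gT : finGroupType.

Definition part_size (X : Type) (p : X * posnat) : nat := val p.2.

(** The degree is a natural number, not a positive one, so that it can range
    over the summation index of Newton's identity; in degree 0 it vanishes. *)
Definition linear_park (R : comNzRingType) m (b : Conj gT -> R) : Parks gT R :=
  if insub m is Some q then \sum_C << b C *g msetn 1 (C, q) >> else 0.

Lemma seq_mset_eq1 (X : choiceType) (c : seq X) p :
  (seq_mset c == msetn 1 p) = (c == [:: p]).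
Proof.
suff -> : msetn 1 p = seq_mset [:: p].
  apply/eqP/eqP => [/eq_seq_msetP|-> //]; exact: perm_small_eq.
by apply/msetP => q; rewrite mset_seqE msetnE /= addn0 eq_sym; case: eqP.
Qed.

Lemma linear_parkE (R : comNzRingType) m (b : Conj gT -> R) c :
  park_value (linear_park m b) c
  = linear_part (@part_size (Conj gT)) (fun p => b p.1) m c.
Proof.
rewrite /linear_park; case: insubP => [q q0 eq|/negPf m0]; last first.
  rewrite /park_value mcoeff0; case: c => [|p []] //=.
  have := valP p.2; rewrite -/(part_size p); case: eqP => [->|_ _]; last by rewrite mul0r.
  by rewrite m0.
rewrite /park_value raddf_sum /=.
under eq_bigr => C _ do rewrite mcoeffU eq_sym seq_mset_eq1.
case: c => [|[K q'] [|p c]] /=; first by rewrite big1.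
  rewrite (bigD1 K) //= big1 ?addr0 => [|C nCK].
    rewrite mulr_natl; congr (_ *+ nat_of_bool _).
    by rewrite -eq /part_size /= !eqseq_cons !xpair_eqE eqxx andbT.
  by rewrite eqseq_cons xpair_eqE eq_sym (negPf nCK).
by rewrite big1 // => C _; rewrite eqseq_cons andbF.
Qed.

Lemma eq_linear_park (R : comNzRingType) m (b b' : Conj gT -> R) :
  b =1 b' -> linear_park m b = linear_park m b'.
Proof.
move=> eb; rewrite /linear_park; case: insubP => [q _ _|_]; last by [].
by apply: eq_bigr => C _; rewrite eb.
Qed.

Lemma linear_park_sum (R : comNzRingType) I (r : seq I) m (x : I -> R)
    (b : I -> Conj gT -> R) :
  linear_park m (fun K => \sum_(i <- r) x i * b i K)
  = \sum_(i <- r) x i *: linear_park m (b i).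
Proof.
apply: park_valueP => c; rewrite /park_value raddf_sum /=.
under eq_bigr => i _ do rewrite mcoeffZ -/(park_value _ c) linear_parkE.
rewrite -/(park_value _ c) linear_parkE.
case: c => [|p [|]] /=; rewrite ?mulr_sumr; try by rewrite big1 // => i _; rewrite mulr0.
by apply: eq_bigr => i _; rewrite mulrCA.
Qed.

Lemma linear_park_delta (R : comNzRingType) K (q : posnat) :
  linear_park (val q) (fun C => (C == K)%:R) = << msetn 1 (K, q) >> :> Parks gT R.
Proof.
rewrite /linear_park valK (bigD1 K) //= eqxx big1 ?addr0 // => C /negPf->.
exact: monalgU0.
Qed.

Lemma parks_mul_monom1 (R : comNzRingType) p (k : Parts gT) :
  parks_mul << msetn 1 p >> << k >>
  = (k p).+1%:R *: << msetD (msetn 1 p) k >> :> Parks gT R.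
Proof.
apply: park_valueP => c.
apply: (etrans (park_value_mul _ _ c)); rewrite /park_value mcoeffZ !mcoeffU.
have val1 l : park_value (<< l >> : Parks gT R) =1 fun s => ((seq_mset s == l) : nat)%:R.
  by move=> s; rewrite /park_value mcoeffU eq_sym.
rewrite (eq_shuffle c (val1 _) (val1 _)).
have /= -> := shuffle_morph (GRing.natmul 1) (fun s => (seq_mset s == msetn 1 p) : nat)
  (fun s => (seq_mset s == k) : nat) c.
rewrite shuffle_indicatorsE pfact_cons -[in X in (_ %/ (X * _))%N](msetD0 (msetn 1 p)).
rewrite pfact_cons mset0E pfact0 mul1n mul1n mulnK ?pfact_gt0 //.
by rewrite eq_sym mulnC mulr_natr mulrnA.
Qed.

Lemma monomialZ (R : comNzRingType) x (k : Parts gT) :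
  << x *g k >> = x *: << k >> :> Parks gT R.
Proof.
apply/malgP => l; apply: etrans (esym (mcoeffZ _ _ _)).
apply: (etrans (mcoeffU k x l)); rewrite -mulr_natr; congr (x * _).
exact: esym (mcoeffU k 1 l).
Qed.

Lemma park_ind (R : comNzRingType) (W : Parks gT R -> Prop) :
  W 0 -> (forall a f g, W f -> W g -> W (a *: f + g)) ->
  (forall c, W << seq_mset c >>) -> forall f, W f.
Proof.
move=> W0 Wlin Wc f; have Wk : forall k : Parts gT, W << k >> by apply: seq_mset_ind.
rewrite (monalgE f); elim: (enum_fset _) => [|k r IH].
  by rewrite big_nil.
by rewrite big_cons monomialZ; apply: Wlin.
Qed.

Lemma parks_mul1l (R : comNzRingType) (f : Parks gT R) : parks_mul (parks_one gT R) f = f.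
Proof.
apply: park_valueP => c; apply: (etrans (park_value_mul _ _ c)).
rewrite -[RHS]mul1r -shuffle_scalar; apply: eq_shuffle => // s.
by rewrite park_value_one; case: s.
Qed.

Lemma parks_mul_suml (R : comNzRingType) I (r : seq I) (F : I -> Parks gT R) g :
  parks_mul (\sum_(i <- r) F i) g = \sum_(i <- r) parks_mul (F i) g.
Proof.
elim/big_rec2: _ => [|i y x _ <-]; last exact: parks_mulDl.
by rewrite -[X in parks_mul X](scale0r 0) parks_mulZl scale0r.
Qed.

End Generation.

Section ExponentialsGenerate.
Variables (gT : finGroupType) (M : Conj gT -> Conj gT -> rat).
Variable e : nat -> Conj gT -> Parks gT rat.
Hypothesis eE : forall n C c,
  park_value (e n C) c = exp_part (@part_size _) (fun p => M C p.1) n c.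
Variable W : Parks gT rat -> Prop.
Hypothesis W1 : W (parks_one gT rat).
Hypothesis Wlin : forall a f g, W f -> W g -> W (a *: f + g).
Hypothesis We : forall n C f, W f -> W (parks_mul (e n C) f).

Lemma generated0 : W 0.
Proof. by have := Wlin (-1) W1 W1; rewrite scaleN1r addNr. Qed.

Lemma generatedZ a f : W f -> W (a *: f).
Proof. by move=> Wf; rewrite -[_ *: _]addr0; apply/Wlin/generated0. Qed.

Lemma generatedD f g : W f -> W g -> W (f + g).
Proof. by move=> Wf; rewrite -[f]scale1r; apply: Wlin. Qed.

Lemma generated_sum I (r : seq I) (F : I -> Parks gT rat) :
  (forall i, W (F i)) -> W (\sum_(i <- r) F i).
Proof.
by move=> WF; apply: big_ind => //; [apply: generated0 | apply: generatedD].
Qed.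

(** Newton's identity multiplied by f: this is where associativity enters. *)
Lemma newton_parks n C f :
  \sum_(m < n.+1) m%:R *: parks_mul (linear_park m (M C)) (parks_mul (e (n - m) C) f)
  = n%:R *: parks_mul (e n C) f.
Proof.
rewrite -parks_mulZl; under eq_bigr => m _ do rewrite -parks_mulA -parks_mulZl.
rewrite -parks_mul_suml; congr (parks_mul _ f).
apply: park_valueP => c; rewrite [RHS]park_valueZ eE -newton /park_value raddf_sum.
apply: eq_bigr => m _; rewrite /= mcoeffZ; congr (_ * _).
apply: (etrans (park_value_mul _ _ c)); apply: eq_shuffle => s; last exact: eE.
exact: linear_parkE.
Qed.

(** Newton's identity expresses n times the degree n linear part through
    exponentials and linear parts of smaller degree; dividing by n needs
    rational coefficients. *)
Lemma generated_linear m C f : W f -> W (parks_mul (linear_park m (M C)) f).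
Proof.
elim/ltn_ind: m f => -[|n] IH f Wf.
  rewrite /linear_park insubF // -(scale0r 0) parks_mulZl scale0r.
  exact: generated0.
have := newton_parks n.+1 C f; rewrite big_ord_recr /= subnn.
have -> : e 0 C = parks_one gT rat.
  apply: park_valueP => -[|p c]; rewrite eE /exp_part park_value_one.
    by rewrite big_nil mulr1.
  by rewrite /= addn_eq0 /part_size (gtn_eqF (valP p.2)) mul0r.
rewrite parks_mul1l => /(canRL (addKr _)) h.
have nz : n.+1%:R != 0 :> rat by rewrite pnatr_eq0.
rewrite -[parks_mul _ f](scalerK nz) h -scaleN1r.
apply/generatedZ/Wlin; last exact/generatedZ/We.
apply: generated_sum => i; apply: generatedZ.
by apply: (IH _ (ltn_ord i)); apply: We.
Qed.

Hypothesis M_inv : forall K, exists x : Conj gT -> rat,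
  forall K', \sum_C x C * M C K' = (K' == K)%:R.

(** A subspace that contains the unit and is stable under multiplication by the
    exponentials is stable under multiplication by linear parts, hence, M being
    invertible, by each single generator, and so contains all monomials. The
    stability under left multiplication alone is asked for because the product
    of two elements of W is not controlled. *)
Lemma exponentials_generate f : W f.
Proof.
apply: park_ind Wlin _ f; first exact: generated0.
elim=> [|[K q] c IH]; first by rewrite seq_mset_nil; apply: W1.
have nz : (seq_mset c (K, q)).+1%:R != 0 :> rat by rewrite pnatr_eq0.
rewrite seq_mset_cons -[<< _ >>](scalerK nz) -parks_mul_monom1; apply: generatedZ.
rewrite -linear_park_delta; have [x xK] := M_inv K.
have -> : linear_park (val q) (fun C => (C == K)%:R)
    = \sum_C x C *: linear_park (val q) (M C) :> Parks gT rat.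
  rewrite -(linear_park_sum _ _ x M); apply: eq_linear_park => C.
  by rewrite xK.
rewrite parks_mul_suml; under eq_bigr => C _ do rewrite parks_mulZl.
by apply: generated_sum => C; apply/generatedZ/generated_linear.
Qed.

End ExponentialsGenerate.

(** * Averaging over decorations *)

Section Average.
Variables (K : fieldType) (X : finType) (D T : Type) (h : X -> D -> T).
Implicit Types (F G : seq T -> K) (d : seq D).

Fixpoint average F d : K :=
  if d is m :: d' then #|X|%:R^-1 * \sum_x average (fun s => F (h x m :: s)) d'
  else F [::].

Lemma eq_average F G d : F =1 G -> average F d = average G d.
Proof.
elim: d F G => [|m d IH] F G eFG /=; first exact: eFG.
by congr (_ * _); apply: eq_bigr => x _; apply: IH => s; apply: eFG.
Qed.

Lemma averageD F G d : average (fun s => F s + G s) d = average F d + average G d.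
Proof.
elim: d F G => [|m d IH] F G //=; rewrite -mulrDr -big_split.
by congr (_ * _); apply: eq_bigr => x _; apply: IH.
Qed.

Lemma averageZ a F d : average (fun s => a * F s) d = a * average F d.
Proof.
elim: d F => [|m d IH] F //=; rewrite [RHS]mulrCA [a * _]mulr_sumr.
by congr (_ * _); apply: eq_bigr => x _; apply: IH.
Qed.

(** A decoration of d is a pair of independent decorations of any two
    complementary subsequences of d. *)
Lemma average_shuffle F G d :
  average (shuffle F G) d = shuffle (average F) (average G) d.
Proof.
elim: d F G => [|m d IH] F G //=.
rewrite shuffleZl shuffleZr -mulrDr shuffle_suml shuffle_sumr -big_split /=.
by congr (_ * _); apply: eq_bigr => x _; rewrite averageD !IH.
Qed.

(** The average of a product over independent choices is the product of the
    averages. *)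
Lemma average_exp (w : T -> nat) (a : T -> K) (v : D -> nat) n d :
  (forall x m, w (h x m) = v m) ->
  average (exp_part w a n) d
  = exp_part v (fun m => #|X|%:R^-1 * \sum_x a (h x m)) n d.
Proof.
move=> wv; rewrite /exp_part.
rewrite -[sumn (map v d)]add0n (@eq_average _ (fun c =>
  (0 + sumn (map w c) == n)%N%:R * \prod_(p <- c) a p)) //.
elim: d 0%N => [|m d IH] j; first by rewrite /= !big_nil.
rewrite exp_part_cons /= -mulrA mulr_suml; congr (_ * _); apply: eq_bigr => x _.
rewrite (@eq_average _ (fun c => a (h x m) *
   ((j + v m + sumn (map w c) == n)%N%:R * \prod_(p <- c) a p))).
  by rewrite averageZ IH.
by move=> s; rewrite exp_part_cons wv.
Qed.

End Average.

Lemma big_decorations_cons (V : nmodType) (X : finType) m (d : seq posnat)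
    (F : composition X -> V) :
  \sum_(c <- decorations X (m :: d)) F c
  = \sum_x \sum_(c <- decorations X d) F ((x, m) :: c).
Proof.
rewrite (perm_big [seq (x, m) :: c | x <- index_enum X, c <- decorations X d]) /=.
  by rewrite big_allpairs_dep.
apply: uniq_perm; first exact: decorations_uniq.
  apply: allpairs_uniq; rewrite ?index_enum_uniq ?decorations_uniq //.
  by move=> [x c] [y c'] _ _ /= [-> ->].
move=> c; rewrite mem_decorations; apply/eqP/allpairsP.
  case: c => [|[x q] c] //= [-> <-]; exists (x, c).
  by split; rewrite ?mem_index_enum ?mem_decorations.
by case=> -[x c'] [_ /=]; rewrite mem_decorations => /eqP <- ->.
Qed.

Lemma average_decorations (K : fieldType) (X : finType) (Y : choiceType)
    (s : X -> Y) (F : composition Y -> K) d :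
  (#|X|%:R ^+ size d)^-1 * \sum_(c <- decorations X d) F (comp_map s c)
  = average (fun x (m : posnat) => (s x, m)) F d.
Proof.
elim: d F => [|m d IH] F /=.
  rewrite expr0 invr1 mul1r (perm_big [:: [::]]) ?big_seq1 //.
  apply: uniq_perm; rewrite ?decorations_uniq // => c.
  by rewrite mem_decorations inE; case: c.
rewrite big_decorations_cons exprS invfM -mulrA mulr_sumr.
by congr (_ * _); apply: eq_bigr => x _; rewrite -IH.
Qed.
(** * Coset spaces and the table of marks *)

Lemma ffunMz (aT : finType) (f : {ffun aT -> int}) z x : (f *~ z) x = f x * z.
Proof.
rewrite -mulrzz; case: z => n; first by rewrite -!pmulrn ffunMnE.
by rewrite !NegzE !mulrNz ffunE -!pmulrn ffunMnE.
Qed.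

Section Cosets.
Variable gT : finGroupType.
Implicit Types (H K : {group gT}) (C : Conj gT).

Lemma cclassJ H x : cclass (H :^ x)%G = cclass H.
Proof. by apply: val_inj; apply/orbit_eqP/imsetP; exists x; rewrite ?inE. Qed.

Lemma conj_rep_cclass H : exists x, conj_rep (cclass H) = (H :^ x)%G.
Proof.
have /(congr1 val)/= := conj_repK (cclass H) => /orbit_eqP/imsetP[x _ ->].
by exists x.
Qed.

Section Coset.
Variable H : {group gT}.
Local Notation to := (gset_act (coset_gset H)).

Fact coset_base_subproof : (H : {set gT}) \in rcosets H [set: gT].
Proof. by apply/rcosetsP; exists 1%g; rewrite ?inE ?rcoset1. Qed.

(** The coset H itself, with stabiliser H; all points are translates of it. *)
Definition coset_base : coset_gset H := exist _ (H : {set gT}) coset_base_subproof.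

Lemma coset_base_trans x : exists y, x = to coset_base y.
Proof.
case: x => S HS; have /rcosetsP[y _ defS] := HS; exists y.
by apply: val_inj; rewrite /= rcosetE.
Qed.

Lemma coset_base_astab : 'C[coset_base | to]%g = H.
Proof.
rewrite -[RHS](astab1Rs H); apply/setP=> a; apply/astab1P/astab1P => [/(congr1 val) //|e].
exact: val_inj.
Qed.

Lemma cclass_astab_coset x : cclass 'C[x | to]%G = cclass H.
Proof.
have [y ->] := coset_base_trans x; rewrite -(cclassJ H y); congr cclass.
by apply: group_inj; apply: (etrans (astab1_act to _ _)); rewrite coset_base_astab.
Qed.

Lemma afix_coset K x : (x \in 'Fix_to(K)%g) -> exists y, K \subset (H :^ y)%g.
Proof.
have [y ->] := coset_base_trans x => /afixP fix_y; exists y.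
rewrite -sub_afixRs_norms; apply/afixP => a Ka.
by have /(congr1 val)/= := fix_y a Ka; rewrite !rcosetE.
Qed.

Lemma coset_base_fix : coset_base \in 'Fix_to(H)%g.
Proof.
by apply/afixP => a Ha; apply/val_inj; rewrite /= rcosetE rcoset_id.
Qed.

(** The canonical basis of the Burnside ring consists of classes of sets, so
    that power operations on basis elements are classes of sets as well. *)
Lemma gclass_coset : gclass (coset_gset H) = [ffun C => (C == cclass H)%:R].
Proof.
apply/ffunP => C; rewrite !ffunE.
have -> : [set orbit to [set: gT] x | x in [set: coset_gset H] &
                cclass 'C[x | to]%G == C]
     = if C == cclass H then [set orbit to [set: gT] coset_base] else set0.
  apply/setP => O; case: ifPn => [/eqP CH | nCH].
    rewrite inE; apply/imsetP/eqP => [[x _ ->] | ->].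
      have [y ->] := coset_base_trans x.
      by apply/orbit_eqP; apply: mem_orbit; rewrite inE.
    by exists coset_base => //; rewrite !inE cclass_astab_coset CH eqxx.
  rewrite in_set0; apply/negP=> /imsetP[x]; rewrite !inE cclass_astab_coset eq_sym.
  by rewrite (negPf nCH).
by case: eqP; rewrite ?cards1 ?cards0.
Qed.
End Coset.

Lemma card_afixJ (X : gset gT) K x :
  #|'Fix_(gset_act X)(K :^ x)%g| = #|'Fix_(gset_act X)(K)%g|.
Proof.
rewrite -[RHS](card_imset _ (act_inj (gset_act X) x)); apply: eq_card => y.
apply/afixP/imsetP => [fix_y | [z /afixP fix_z ->] a /imsetP[b Kb ->]].
  exists (gset_act X y x^-1)%g; last by rewrite actKV.
  apply/afixP => b Kb; rewrite -!actM.
  have /fix_y {2}<- : (b ^ x)%g \in (K :^ x)%g by rewrite memJ_conjg.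
  by rewrite -actM conjgE !mulgA mulgK.
by rewrite -!actM -conjgC actM fix_z.
Qed.

(** The orbit counting lemma. The representative of the class of <[g]> is only
    conjugate to <[g]>, which does not change the number of fixed points. *)
Lemma sum_card_fix_cyclic (X : gset gT) :
  (\sum_g #|'Fix_(gset_act X)(conj_rep (cyclic_class g))%g|
   = #|gset_orbits X| * #|gT|)%N.
Proof.
have actsT : [acts [set: gT], on [set: X] | gset_act X].
  by apply/actsP=> a _ x; rewrite !inE.
rewrite -cardsT -(Frobenius_Cauchy actsT); apply: eq_big => [g|g _].
  by rewrite inE.
have [x ->] := conj_rep_cclass <[g]>%G.
by rewrite setTI /= card_afixJ afix_cycle.
Qed.

End Cosets.

Section Marks.
Variable gT : finGroupType.
Implicit Types C K : Conj gT.

Definition mark_table C K : nat :=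
  #|'Fix_(gset_act (coset_gset (conj_rep C)))(conj_rep K)%g|.

Lemma mark_gclass_coset C K :
  mark (gclass (coset_gset (conj_rep C))) K = (mark_table C K)%:R.
Proof.
rewrite gclass_coset conj_repK /mark /burnside_ext (bigD1 C) //= ffunE eqxx.
rewrite big1 ?addr0 => [|D /negPf nDC]; last by rewrite ffunE nDC mulr0z.
by rewrite mulr1n mulr1z natz.
Qed.

Lemma mark_table_diag C : mark_table C C != 0%N.
Proof.
by rewrite -lt0n; apply/card_gt0P; exists (coset_base _); apply: coset_base_fix.
Qed.

(** A fixed point of K in the cosets of H embeds K into a conjugate of H. *)
Lemma mark_table_triangular C K :
  mark_table C K != 0%N -> K != C -> (#|conj_rep K| < #|conj_rep C|)%N.
Proof.
rewrite -lt0n => /card_gt0P[x /afix_coset[y sKC]]; apply: contraNltn => leCK.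
have eKC : conj_rep K = (conj_rep C :^ y)%G.
  by apply/val_inj/eqP; rewrite eqEcard sKC cardJg.
by rewrite -(conj_repK K) -(conj_repK C) eKC cclassJ.
Qed.

(** A triangular matrix with nonzero diagonal is invertible over the rationals.
    The row of K is supported on K and on classes L of smaller order, whose
    indicator functions are combinations of rows by induction on the order. *)
Lemma mark_table_inv K : exists x : Conj gT -> rat,
  forall K', \sum_C x C * (mark_table C K')%:R = (K' == K)%:R.
Proof.
have [n] := ubnP #|conj_rep K|; elim: n K => // n IH K /ltnSE leKn.
have /fin_all_exists[x xP] : forall L, exists x : Conj gT -> rat,
    (#|conj_rep L| < #|conj_rep K|)%N ->
    forall K', \sum_C x C * (mark_table C K')%:R = (K' == L)%:R.
  move=> L; case: (ltnP #|conj_rep L| #|conj_rep K|) => [ltLK|_].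
    by have [x xP] := IH L (leq_trans ltLK leKn); exists x.
  by exists (fun=> 0).
pose t C L : rat := (mark_table C L)%:R.
have tKK : t K K != 0 by rewrite pnatr_eq0 mark_table_diag.
exists (fun C => (t K K)^-1 * ((C == K)%:R
  - \sum_(L | (#|conj_rep L| < #|conj_rep K|)%N) t K L * x L C)) => K'.
transitivity ((t K K)^-1 * (t K K'
  - \sum_(L | (#|conj_rep L| < #|conj_rep K|)%N) t K L * (K' == L)%:R)).
  under eq_bigr => C _ do rewrite -mulrA mulrBl.
  rewrite -mulr_sumr sumrB; congr (_ * (_ - _)).
    rewrite (bigD1 K) //= eqxx mul1r big1 ?addr0 // => C /negPf->.
    by rewrite mul0r.
  under eq_bigr => C _ do rewrite mulr_suml.
  rewrite exchange_big; apply: eq_bigr => L ltLK /=.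
  by rewrite -(xP L ltLK) mulr_sumr; apply: eq_bigr => C _; rewrite mulrA.
have [->|nK'K] := eqVneq K' K.
  rewrite big1 ?subr0 ?mulVf // => L ltLK.
  by case: eqP ltLK => [<-|]; rewrite ?ltnn ?mulr0.
case: (boolP (#|conj_rep K'| < #|conj_rep K|)%N) => [lt|nlt].
  rewrite (bigD1 K') //= eqxx mulr1 big1 ?addr0 ?subrr ?mulr0 // => L /andP[_].
  by rewrite eq_sym => /negPf->; rewrite mulr0.
have tKK' : mark_table K K' = 0%N.
  by apply/eqP; apply: contraNT nlt => /mark_table_triangular; apply.
rewrite /t tKK' big1 ?subr0 ?mulr0 // => L ltLK.
by case: eqP ltLK nlt => [<- ->|]; rewrite ?mulr0.
Qed.

Lemma Conj_trivg (C : Conj trivg) : C = cclass [1 trivg].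
Proof.
rewrite -(conj_repK C); congr cclass; apply/val_inj/setP=> x.
by case: x; rewrite /= (group1 (conj_rep C)) set11.
Qed.

(** For the trivial group the only transitive set is a point. *)
Lemma mark_trivg (a : burnside trivg) (C : Conj trivg) : mark a C = a C.
Proof.
rewrite /mark /burnside_ext (bigD1 C) //= big1 ?addr0; last first.
  by move=> D; rewrite (Conj_trivg C) (Conj_trivg D) eqxx.
suff -> : #|'Fix_(gset_act (coset_gset (conj_rep C)))(conj_rep C)%g| = 1%N.
  by rewrite intz.
apply: (@eq_card1 _ (coset_base (conj_rep C))) => x.
rewrite (_ : x \in _ = true); last first.
  have [y ->] := coset_base_trans x; case: y; apply/afixP => -[] _.
  by rewrite -!actM.
apply/esym/eqP; have [y ->] := coset_base_trans x; case: y.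
exact: act1.
Qed.

Lemma gclass_orbit_gset (X : gset gT) (C : Conj trivg) :
  gclass (orbit_gset X) C = #|gset_orbits X|%:R.
Proof.
rewrite ffunE natz; congr (Posz _).
transitivity #|[set: {O : {set X} | O \in gset_orbits X}]|; last first.
  by rewrite cardsT card_sig; apply: eq_card => O; rewrite !inE.
rewrite -[RHS](card_imset _ set1_inj); apply: eq_card => S.
apply/imsetP/imsetP => -[O]; rewrite !inE => h ->; exists O; rewrite ?inE //.
- apply/setP=> z; rewrite inE; apply/imsetP/eqP => [[a _ ->]|->] //.
  by exists 1%g; rewrite ?inE.
- by apply/eqP; rewrite (Conj_trivg C); apply: Conj_trivg.
- apply/setP=> z; rewrite inE; apply/eqP/imsetP => [->|[a _ ->]] //.
  by exists 1%g; rewrite ?inE.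
Qed.

(** By additivity it is enough to treat a transitive set, where the identity is
    the orbit counting lemma. *)
Lemma mark_burnside_tr (x : burnside gT) (C : Conj trivg) :
  (mark (burnside_tr x) C)%:~R
  = #|gT|%:R^-1 * \sum_g (mark x (cyclic_class g))%:~R :> rat.
Proof.
have nz : #|gT|%:R != 0 :> rat.
  by rewrite pnatr_eq0 -lt0n -cardsT; apply: cardG_gt0.
apply: (mulfI nz); rewrite mulVKf // -rmorph_sum mark_trivg.
rewrite -[#|gT|%:R](rmorph_nat intr) -rmorphM /=; congr _%:~R.
rewrite /mark /burnside_ext exchange_big /burnside_tr /burnside_ext sum_ffunE mulr_sumr.
apply: eq_bigr => D _; rewrite -mulrz_suml.
rewrite ffunMz gclass_orbit_gset mulrzz mulrA; congr (_ * _).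
under [RHS]eq_bigr => g _ do rewrite -natz.
by rewrite -natr_sum sum_card_fix_cyclic natrM mulrC.
Qed.

End Marks.

(** * Products of power operations *)

Section Partitions.
Variable X : choiceType.
Implicit Type c : composition X.

Lemma psize_seq_mset c : psize (seq_mset c) = sumn (map (@part_size X) c).
Proof.
rewrite /psize -(sum_mset _ xpredT (@part_size X)).
rewrite (perm_big _ (perm_eq_seq_mset c)) /=.
by rewrite sumnE big_map.
Qed.

Lemma plength_seq_mset c : plength (seq_mset c) = size c.
Proof.
rewrite -sum1_size -(perm_big _ (perm_eq_seq_mset c)) /= sum_mset.
by apply: eq_bigr => p _; rewrite muln1.
Qed.

Lemma prod_finsupp_seq_mset (R : comNzRingType) (a : X * posnat -> R) c :
  \prod_(p <- finsupp (seq_mset c)) a p ^+ seq_mset c p = \prod_(p <- c) a p.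
Proof.
rewrite -(perm_big _ (perm_eq_seq_mset c)) /= big_mset.
by apply: eq_bigr => p _; rewrite Monoid.iteropE -iter_mulr_1.
Qed.

End Partitions.

Section PowerProducts.
Variable gT : finGroupType.
Variable P : forall n, burnside gT -> burnside (wreath gT n).
Hypothesis P_power : is_total_power P.

(** Iterated transfer products of powers of actual finite sets. Virtual sets
    are excluded since their powers may have negative coefficients. *)
Inductive power_product : forall n, burnside (wreath gT n) -> Prop :=
| power_product_one : power_product (burnside_one (wreath gT 0))
| power_productM m n (X : gset gT) (a : burnside (wreath gT n)) :
    power_product a -> power_product (transfer_prod (P m (gclass X)) a).

Definition effective (hT : finGroupType) (a : burnside hT) := forall C, 0 <= a C.

Lemma gclass_effective (hT : finGroupType) (X : gset hT) : effective (gclass X).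
Proof. by move=> C; rewrite ffunE. Qed.

Lemma transfer_prodE m n (a : burnside (wreath gT m)) (b : burnside (wreath gT n)) C :
  transfer_prod a b C = \sum_D \sum_E
    gclass (transfer_gset (coset_gset (conj_rep D)) (coset_gset (conj_rep E))) C
    * (b E * a D).
Proof.
rewrite /transfer_prod /burnside_ext sum_ffunE; apply: eq_bigr => D _.
rewrite ffunMz sum_ffunE mulr_suml; apply: eq_bigr => E _.
by rewrite ffunMz mulrA.
Qed.

Lemma transfer_prod_effective m n (a : burnside (wreath gT m))
    (b : burnside (wreath gT n)) :
  effective a -> effective b -> effective (transfer_prod a b).
Proof.
move=> a0 b0 C; rewrite transfer_prodE; apply: sumr_ge0 => D _; apply: sumr_ge0 => E _.
by rewrite !mulr_ge0 ?gclass_effective.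
Qed.

Lemma transfer_prod_le m n (a a' : burnside (wreath gT m))
    (b b' : burnside (wreath gT n)) :
  effective a -> effective b -> (forall C, a C <= a' C) -> (forall C, b C <= b' C) ->
  forall C, transfer_prod a b C <= transfer_prod a' b' C.
Proof.
move=> a0 b0 aa' bb' C; rewrite !transfer_prodE; apply: ler_sum => D _.
apply: ler_sum => E _; apply: ler_wpM2l; first exact: gclass_effective.
exact: ler_pM.
Qed.

Lemma ecast_effective m n (e : m = n) (a : burnside (wreath gT m)) :
  effective a -> effective (ecast k (burnside (wreath gT k)) e a).
Proof. by case: n / e. Qed.

Lemma power_add_effective n x y :
  (forall k, effective (P k x)) -> (forall k, effective (P k y)) ->
  effective (P n (x + y)).
Proof.
move=> x0 y0 C; have [_ _ ->] := P_power; rewrite sum_ffunE; apply: sumr_ge0 => i _.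
exact/ecast_effective/transfer_prod_effective.
Qed.

(** The left hand side is one of the summands in the expansion of
    P_(m + n)(x + y), and the other summands are nonnegative. *)
Lemma transfer_prod_le_power m n x y :
  (forall k, effective (P k x)) -> (forall k, effective (P k y)) ->
  forall C, transfer_prod (P m x) (P n y) C <= P (m + n) (x + y) C.
Proof.
move=> x0 y0 C; have [_ _ ->] := P_power.
have ltm : (m < (m + n).+1)%N by rewrite ltnS leq_addr.
rewrite (bigD1 (Ordinal ltm)) //= [X in _ <= X]ffunE -[X in X <= _]addr0.
apply: lerD; last first.
  rewrite sum_ffunE; apply: sumr_ge0 => i _.
  exact/ecast_effective/transfer_prod_effective.
(* The summand of index m has m + n - m in place of n. *)
suff ecast_eq j (ej : j = n) (e : (m + j = m + n)%N) :
    ecast k (burnside (wreath gT k)) e (transfer_prod (P m x) (P j y))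
    = transfer_prod (P m x) (P n y) by rewrite ecast_eq // addKn.
by move: e; rewrite ej => e; rewrite (eq_axiomK e).
Qed.

(** The bound is the power of the sum of the sets in the product. Nonnegativity
    of all P k x is carried along because x is no longer the class of a single
    set. *)
Lemma power_product_le n (a : burnside (wreath gT n)) : power_product a ->
  effective a /\ exists2 x, forall k, effective (P k x) & forall C, a C <= P n x C.
Proof.
have [PX P0 _] := P_power; have gX k X : effective (P k (gclass X)).
  by rewrite PX; apply: gclass_effective.
elim=> {n a} [|m n X a _ [a0 [x x0 ax]]].
  split; first exact: gclass_effective.
  (* All sets have the same power of exponent 0. *)
  by exists (gclass (trivial_gset gT unit)) => // C; rewrite P0.
split; first exact: transfer_prod_effective.
exists (gclass X + x) => [k|C]; first exact: power_add_effective.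
have le_power := @transfer_prod_le_power m n _ _ (gX ^~ X) x0 C.
apply: (Order.POrderTheory.le_trans _ le_power).
by apply: transfer_prod_le.
Qed.

(** An element between 0 and P_n x involves only basis elements that occur in
    P_n x. *)
Lemma power_product_summand n (a : burnside (wreath gT n)) :
  power_product a -> power_summand P a.
Proof.
case/power_product_le => a0 [x _ ax] B spanB C nBC; apply/eqP.
by rewrite Order.POrderTheory.eq_le a0 andbT -(spanB x C nBC) ax.
Qed.

Lemma power_summandP n x : power_summand P (P n x).
Proof. by move=> B; apply. Qed.

Variable chi : forall n, burnside (wreath gT n) -> Parks gT int.
Hypothesis chi_hom : is_parks_hom P chi.

(** The defining property of the parks homomorphism, read on compositions. *)
Lemma park_value_power n x c :
  park_value (parks_rat (chi (P n x))) c
  = exp_part (@part_size _) (fun p => (mark x p.1)%:~R) n c.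
Proof.
have [chiP chi0 _ _ _] := chi_hom.
rewrite park_value_rat /exp_part -psize_seq_mset; case: eqP => [sz|/eqP sz].
  rewrite /park_value (chiP n x _ sz) mul1r -(rmorph_prod intr).
  by rewrite prod_finsupp_seq_mset.
by rewrite /park_value (chi0 n _ _ _ sz) ?mul0r //; apply: power_summandP.
Qed.

Lemma parks_rat_chi_mul m n (a : burnside (wreath gT m)) (b : burnside (wreath gT n)) :
  power_summand P a -> power_summand P b ->
  parks_rat (chi (transfer_prod a b)) = parks_mul (parks_rat (chi a)) (parks_rat (chi b)).
Proof.
by move=> Pa Pb; have [_ _ _ _ chiM] := chi_hom; rewrite chiM // parks_rat_mul.
Qed.

(** The linear span of the parks of power products. It is kept separate from
    the products since additional information, the transfer of the underlying
    Burnside ring element, is available on products only. *)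
Inductive power_span : Parks gT rat -> Prop :=
| power_span_product n (a : burnside (wreath gT n)) :
    power_product a -> power_span (parks_rat (chi a))
| power_span_linear s f g : power_span f -> power_span g -> power_span (s *: f + g).

Lemma power_spanM m X f : power_span f ->
  power_span (parks_mul (parks_rat (chi (P m (gclass X)))) f).
Proof.
elim=> {f} [n a pa | s f g _ IHf _ IHg].
  rewrite -parks_rat_chi_mul; last exact: power_product_summand.
    by apply/power_span_product/power_productM.
  exact: power_summandP.
by rewrite parks_mulDr parks_mulZr; apply: power_span_linear.
Qed.

Lemma power_span_full f : power_span f.
Proof.
have [_ _ _ chi1 _] := chi_hom.
apply: (@exponentials_generate gT (fun C K => (mark_table C K)%:R)
  (fun n C => parks_rat (chi (P n (gclass (coset_gset (conj_rep C))))))).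
- move=> n C c; rewrite park_value_power /exp_part; congr (_ * _).
  by apply: eq_bigr => p _; rewrite mark_gclass_coset rmorph_nat.
- by rewrite -parks_rat_one -chi1; apply/power_span_product/power_product_one.
- exact: power_span_linear.
- by move=> n C g; apply: power_spanM.
- exact: mark_table_inv.
Qed.

End PowerProducts.

(** * The transfer formula *)

Section TransferFormula.
Variables (gT : finGroupType) (Tr : {linear Parks gT rat -> Parks trivg rat}).
Variables (PG : forall n, burnside gT -> burnside (wreath gT n))
  (Pe : forall n, burnside trivg -> burnside (wreath trivg n))
  (chiG : forall n, burnside (wreath gT n) -> Parks gT int)
  (chie : forall n, burnside (wreath trivg n) -> Parks trivg int)
  (Fo : forall n, burnside (wreath gT n) -> burnside (wreath trivg n)).
Hypotheses (PG_power : is_total_power PG) (chiG_hom : is_parks_hom PG chiG).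
Hypotheses (chie_hom : is_parks_hom Pe chie).
Hypothesis Fo_hom : is_power_hom (@burnside_tr gT) PG Pe Fo.
Hypothesis TrE : forall n a, power_summand PG a ->
  Tr (parks_rat (chiG (n := n) a)) = parks_rat (chie (Fo a)).

Local Notation undecorated d := [seq (cclass [1 trivg], m) | m <- d].
Local Notation cyclic_average :=
  (average (fun (g : gT) (m : posnat) => (cyclic_class g, m))).

Definition transfer_formula f := forall d : seq posnat,
  park_value (Tr f) (undecorated d) = cyclic_average (park_value f) d.

(** Both sides are exponentials, whose weights agree by orbit counting. *)
Lemma transfer_formula_power n x : transfer_formula (parks_rat (chiG (PG n x))).
Proof.
move=> d; have [FoP _ _ _ _] := Fo_hom.
rewrite TrE ?FoP; last exact: power_summandP.
rewrite (park_value_power chie_hom) (eq_average _ _ (park_value_power chiG_hom n x)).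
rewrite (average_exp _ (v := fun m : posnat => val m)) // /exp_part -map_comp big_map.
by congr (_ * _); apply: eq_bigr => m _; apply: mark_burnside_tr.
Qed.

(** Transfer, parks homomorphisms and averaging are all multiplicative. *)
Lemma transfer_formula_product n (a : burnside (wreath gT n)) :
  power_product PG a -> transfer_formula (parks_rat (chiG a)).
Proof.
have [_ P0 _] := PG_power; have [FoP FoS _ _ FoM] := Fo_hom.
elim=> {n a} [|m n X a pa IH]; first by rewrite -(P0 0); apply: transfer_formula_power.
have Sa := power_product_summand PG_power pa.
have Sx : power_summand PG (PG m (gclass X)) by exact: power_summandP.
move=> d; rewrite TrE; last exact: power_product_summand (power_productM m X pa).
rewrite FoM // (parks_rat_chi_mul chie_hom); try exact: FoS.
rewrite (parks_rat_chi_mul chiG_hom) //.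
rewrite -!TrE //; apply: (etrans (park_value_mul _ _ _)).
rewrite (eq_average _ _ (park_value_mul _ _)) average_shuffle shuffle_map.
apply: eq_shuffle => s; [exact: transfer_formula_power | exact: IH].
Qed.

Lemma transfer_formula_full f : transfer_formula f.
Proof.
elim: (power_span_full PG_power chiG_hom f) => {f} [n a|s f g _ IHf _ IHg d].
  exact: transfer_formula_product.
rewrite linearP park_valueD park_valueZ IHf IHg -averageZ -averageD.
by apply: eq_average => c; rewrite park_valueD park_valueZ.
Qed.

End TransferFormula.

Theorem proposition16p6 (gT : finGroupType)
    (Tr : {linear Parks gT rat -> Parks trivg rat})
    (Tr_transfer : is_parks_transfer Tr)
    (f : Parks gT rat) (l : Parts trivg)
    (d : seq posnat) (d_l : underlies d l) :
  (Tr f)@_l =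
    (#|gT|%:R ^+ plength l)^-1 *
    \sum_(c <- decorations gT d) f@_(comp_partition (comp_map (@cyclic_class gT) c)).
Proof.
have [PG [Pe [chiG [chie [Fo [PGP _ chiGH [chieH FoH TrE]]]]]]] := Tr_transfer.
rewrite -d_l plength_seq_mset size_map.
rewrite (average_decorations (@cyclic_class gT) (park_value f) d).
exact: transfer_formula_full PGP chiGH chieH FoH TrE f d.
Qed.
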